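(* For all positive integers $k$ and $n$ and every real $x$, $$\sum_{j=0}^{n-k}(-1)^j\binom{n}{j}(1-x)^jB_k^{n-j}(x)=\begin{cases}x^k, & \text{if } n=k,\\ 0, & \text{if } n\neq k,\end{cases}$$ where $B_k^n$ denotes the Bernstein basis function.
   Context: The Bernstein basis functions are $B_k^n(x)=\binom{n}{k}x^k(1-x)^{n-k}$ for integers $0\le k\le n$ (with $0^0=1$). If $n<k$ the sum is empty (equal to $0$). *)

(* Defs.v *)
From mathcomp Require Import all_boot all_order all_algebra reals.

Set Implicit Arguments.
Unset Strict Implicit.
Unset Printing Implicit Defensive.

Import GRing.Theory.
Local Open Scope ring_scope.

(* B_k^n(x), for k <= n; the convention 0^0 = 1 is that of _ ^+ 0. For k > n
   the binomial coefficient vanishes, so the value is 0. *)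
Definition bernstein (R : realType) (k n : nat) (x : R) : R :=
  'C(n, k)%:R * x ^+ k * (1 - x) ^+ (n - k).

(* Main.v *)
(** Since [C(n,j) C(n-j,k) = C(n,k) C(n-k,j)], the sum factors as
    [C(n,k) x^k (1-x)^(n-k)] times [\sum_j (-1)^j C(n-k,j) = (1-1)^(n-k)]. *)

Require Import Defs.
From mathcomp Require Import all_boot all_order all_algebra reals ring.

Import GRing.Theory.
Local Open Scope ring_scope.

(** By [mul_bin_swap], and since the exponents of 1-x always add up to n-k, the j-th term is
    B_k^n(x) times (-1)^j C(n-k,j). The remaining alternating sum, [sum_sign_bin], vanishes unless n
    = k. *)

Lemma mul_bin_swap (n j k : nat) : (j + k <= n)%N ->
  ('C(n, j) * 'C(n - j, k) = 'C(n, k) * 'C(n - k, j))%N.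
Proof.
move=> le_jk_n.
have [le_j_n le_k_n] : (j <= n /\ k <= n)%N.
  by split; apply: leq_trans le_jk_n; rewrite ?leq_addr ?leq_addl.
have le_k_nj : (k <= n - j)%N by rewrite leq_subRL.
have le_j_nk : (j <= n - k)%N by rewrite leq_subRL // addnC.
(* Multiplied by j! k! (n-j-k)!, both sides become n!. *)
apply/eqP; rewrite -(eqn_pmul2r (fact_gt0 j)) -(eqn_pmul2r (fact_gt0 k)).
rewrite -(eqn_pmul2r (fact_gt0 (n - j - k))); apply/eqP.
transitivity n`!.
  by rewrite -(bin_fact le_j_n) -(bin_fact le_k_nj) -!mulnA; congr (_ * _)%N;
     rewrite mulnCA.
rewrite -(bin_fact le_k_n) -(bin_fact le_j_nk) -!mulnA subnAC.
by congr (_ * _)%N; rewrite mulnCA; congr (_ * _)%N; rewrite mulnCA.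
Qed.

(** Binomial expansion of (1-1)^m, with 0^0 = 1 covering m = 0. *)
Lemma sum_sign_bin (R : comPzRingType) (m : nat) :
  \sum_(j < m.+1) (-1) ^+ j * 'C(m, j)%:R = (m == 0)%:R :> R.
Proof.
rewrite -expr0n -[X in X ^+ m](subrr 1) exprBn.
by apply: eq_bigr => j _; rewrite !expr1n !mulr1 mulr_natr.
Qed.

(* MathComp world. The range 0 <= j < n.+1 - k is j = 0, ..., n - k when
   k <= n, and is empty when n < k. *)
Theorem theorem14 (R : realType) (k n : nat) (x : R) :
  (0 < k)%N -> (0 < n)%N ->
  \sum_(0 <= j < (n.+1 - k)%N)
     (-1) ^+ j * 'C(n, j)%:R * (1 - x) ^+ j * bernstein k (n - j)%N x
  = if n == k then x ^+ k else 0.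
Proof.
move=> _ _; have [lt_nk | le_kn] := ltnP n k.
  (* [n < k] unfolds to [n.+1 - k == 0], so [eqP] makes the upper bound of the range 0. *)
  by rewrite (eqP lt_nk) big_geq // (ltn_eqF lt_nk).
rewrite subSn // big_mkord.
transitivity (bernstein k n x *
              \sum_(j < (n - k).+1) (-1) ^+ j * 'C(n - k, j)%:R).
  rewrite mulr_sumr; apply: eq_bigr => j _; rewrite /bernstein.
  have le_j : (j <= n - k)%N by rewrite -ltnS.
  have le_jk : (j + k <= n)%N by rewrite addnC -leq_subRL.
  have -> : (1 - x) ^+ (n - k) = (1 - x) ^+ j * (1 - x) ^+ (n - j - k).
    by rewrite -exprD subnAC subnKC.
  have := congr1 (fun m => m%:R : R) (mul_bin_swap _ _ _ le_jk).
  by rewrite !natrM => binE; ring: binE.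
rewrite sum_sign_bin /bernstein subn_eq0; case: eqVneq => [-> | ne_nk].
  by rewrite leqnn subnn binn expr0 !mulr1 mul1r.
by rewrite leqNgt ltn_neqAle eq_sym ne_nk le_kn mulr0.
Qed.
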